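(* The following twelve mesh patterns $(12,R)$ are pairwise equidistributed, where $R$ ranges over: $\{(0,2),(1,2),(2,2),(0,1),(2,1),(0,0),(1,0)\}$, $\{(1,2),(2,2),(0,1),(2,1),(0,0),(1,0),(2,0)\}$, $\{(0,2),(1,2),(2,2),(1,1),(2,1),(0,0),(1,0)\}$, $\{(0,2),(2,2),(0,1),(1,1),(2,1),(0,0),(1,0)\}$, $\{(1,2),(2,2),(0,1),(1,1),(0,0),(2,1),(2,0)\}$, $\{(1,2),(2,2),(0,1),(1,1),(0,0),(1,0),(2,0)\}$, $\{(0,2),(1,2),(2,2),(1,1),(0,1),(0,0),(2,0)\}$, $\{(0,2),(2,2),(1,1),(2,1),(0,0),(1,0),(2,0)\}$, $\{(0,2),(1,2),(0,1),(1,1),(2,1),(0,0),(2,0)\}$, $\{(0,2),(1,2),(1,1),(0,1),(2,2),(1,0),(2,0)\}$, $\{(0,2),(2,2),(0,1),(1,1),(2,1),(1,0),(2,0)\}$, $\{(0,2),(1,2),(1,1),(2,1),(0,0),(1,0),(2,0)\}$. Moreover, for each such pattern $p$ and each $n\ge 1$, $$\sum_{\pi\in S_n}q^{p(\pi)}=n!-\sum_{i=1}^{n-1}(i-1)!(n-i-1)!+q\sum_{i=1}^{n-1}(i-1)!(n-i-1)!.$$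
   Context: For $R\subseteq\{0,1,2\}^2$ and $\pi=\pi_1\cdots\pi_n\in S_n$, an occurrence of the mesh pattern $(12,R)$ in $\pi$ is a pair of positions $i_1<i_2$ with $\pi_{i_1}<\pi_{i_2}$ such that, setting $x_0=0,x_1=i_1,x_2=i_2,x_3=n+1$ and $y_0=0,y_1=\pi_{i_1},y_2=\pi_{i_2},y_3=n+1$, for every $(a,b)\in R$ there is no index $k$ with $x_a<k<x_{a+1}$ and $y_b<\pi_k<y_{b+1}$. $p(\pi)$ is the number of occurrences of $p$ in $\pi$; $s_{n,k}(p)$ the number of $\pi\in S_n$ with $p(\pi)=k$; $p_1,p_2$ are equidistributed if $s_{n,k}(p_1)=s_{n,k}(p_2)$ for all $n,k\ge 0$. *)

(* Defs.v *)
From mathcomp Require Import all_boot all_order all_fingroup all_algebra.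

Set Implicit Arguments.
Unset Strict Implicit.
Unset Printing Implicit Defensive.

(* Ordinals are 0-based: i : 'I_n stands for the position i.+1, and the
   permutation pi : 'S_n takes there the value (pi i).+1. *)

Definition grid_lines (n c1 c2 : nat) : seq nat := [:: 0; c1; c2; n.+1].

Definition in_strip (g : seq nat) (a : 'I_3) (z : nat) : bool :=
  nth 0 g a < z < nth 0 g a.+1.

Definition mesh12_occurrence (R : {set 'I_3 * 'I_3}) (n : nat) (pi : 'S_n)
    (i1 i2 : 'I_n) : bool :=
  [&& i1 < i2, pi i1 < pi i2 &
    [forall c in R, ~~ [exists k : 'I_n,
      in_strip (grid_lines n i1.+1 i2.+1) c.1 k.+1
      && in_strip (grid_lines n (pi i1).+1 (pi i2).+1) c.2 (pi k).+1]]].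

Definition mesh12_count (R : {set 'I_3 * 'I_3}) (n : nat) (pi : 'S_n) : nat :=
  #|[set i : 'I_n * 'I_n | mesh12_occurrence R pi i.1 i.2]|.

Definition mesh12_distr (n k : nat) (R : {set 'I_3 * 'I_3}) : nat :=
  #|[set pi : 'S_n | mesh12_count R pi == k]|.

Definition equidistributed (R1 R2 : {set 'I_3 * 'I_3}) : Prop :=
  forall n k : nat, mesh12_distr n k R1 = mesh12_distr n k R2.

Definition shading (s : seq (nat * nat)) : {set 'I_3 * 'I_3} :=
  [set c : 'I_3 * 'I_3 | (val c.1, val c.2) \in s].

Definition twelve_shadings : seq {set 'I_3 * 'I_3} :=
  [:: shading [:: (0,2); (1,2); (2,2); (0,1); (2,1); (0,0); (1,0)];
      shading [:: (1,2); (2,2); (0,1); (2,1); (0,0); (1,0); (2,0)];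
      shading [:: (0,2); (1,2); (2,2); (1,1); (2,1); (0,0); (1,0)];
      shading [:: (0,2); (2,2); (0,1); (1,1); (2,1); (0,0); (1,0)];
      shading [:: (1,2); (2,2); (0,1); (1,1); (0,0); (2,1); (2,0)];
      shading [:: (1,2); (2,2); (0,1); (1,1); (0,0); (1,0); (2,0)];
      shading [:: (0,2); (1,2); (2,2); (1,1); (0,1); (0,0); (2,0)];
      shading [:: (0,2); (2,2); (1,1); (2,1); (0,0); (1,0); (2,0)];
      shading [:: (0,2); (1,2); (0,1); (1,1); (2,1); (0,0); (2,0)];
      shading [:: (0,2); (1,2); (1,1); (0,1); (2,2); (1,0); (2,0)];
      shading [:: (0,2); (2,2); (0,1); (1,1); (2,1); (1,0); (2,0)];
      shading [:: (0,2); (1,2); (1,1); (2,1); (0,0); (1,0); (2,0)]].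

(* Main.v *)
Require Import Defs.
From mathcomp Require Import all_boot all_order all_fingroup all_algebra.
From mathcomp Require Import zify.

Set Implicit Arguments.
Unset Strict Implicit.
Unset Printing Implicit Defensive.

(* Each of the twelve patterns leaves exactly two boxes unshaded, and they have
   the form [(a, sigma a)], [a != c], for a permutation [sigma] of {0,1,2} and a
   column [c] with [sigma c != c]; these are all such pairs. Thus column [c] and
   row [sigma c] contain no points, which makes an occurrence unique. With an
   occurrence, the other n-2 points fill the two unshaded boxes, j in one and
   n-2-j in the other: j determines the position and values of the occurrence,
   and each box carries an arbitrary permutation, so there are j! (n-2-j)!
   permutations for each j. *)

(** * Permutations compatible with a labelling *)

(** Induction on [ls]: such a permutation is, in exactly one way, a product of one supported on the
    class of the first label and one of the same kind for the remaining labels. Fixing the points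
    with labels outside [ls] makes this recursion possible. *)
Lemma card_label_stabilizer_seq (T : finType) (L : eqType) (f : T -> L)
    (ls : seq L) : uniq ls ->
  #|[set s : {perm T} | [forall x,
      (f (s x) == f x) && ((f x \notin ls) ==> (s x == x))]]| =
  \prod_(l <- ls) #|[set x | f x == l]|`!.
Proof.
elim: ls => [_|l ls IHls /= /andP[l_ls uniq_ls]].
  rewrite big_nil -(cards1 (1%g : {perm T})); apply: eq_card => s.
  rewrite !inE; apply/forallP/eqP => [s_id|-> x]; last by rewrite perm1 !eqxx.
  by apply/permP => x; have /andP[_ /eqP ->] := s_id x; rewrite perm1.
rewrite big_cons -(IHls uniq_ls) -card_perm.
set F := [set x | f x == l]; set H := (X in _ * #|pred_of_set X|).
have HP (s : {perm T}) : reflect (forall x, f (s x) = f x /\ (f x \notin ls -> s x = x))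
                    (s \in H).
  rewrite inE; apply: (iffP forallP) => s_f x.
    by have /andP[/eqP -> /implyP sx] := s_f x; split=> // /sx /eqP.
  by have [-> sx] := s_f x; rewrite eqxx; apply/implyP => /sx ->.
rewrite -(cardsE (perm_on F)) -cardsX -(@card_in_imset _ _ (fun u => u.1 * u.2)%g).
  apply: eq_card => s; apply/idP/imsetP => [|[[u v]]].
    rewrite inE => /forallP s_f.
    have sF : s \in ('N(F | 'P))%g.
      rewrite !inE /=; apply/subsetP => x; rewrite !inE /= /aperm.
      by have /andP[/eqP -> _] := s_f x.
    exists (restr_perm F s, (restr_perm F s)^-1 * s)%g; last by rewrite mulKVg.
    apply/setXP; split; first by rewrite in_set; apply: restr_perm_on.
    apply/HP => x; rewrite permM /=.
    set y := ((restr_perm F s)^-1)%g x; have yx : restr_perm F s y = x by rewrite permKV.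
    have [yF|yF] := boolP (y \in F).
      by move: yx; rewrite restr_permE // => ->.
    have xy : x = y by rewrite -yx (out_perm (restr_perm_on F s)).
    have /andP[/eqP fy /implyP sy] := s_f x.
    rewrite -xy; split=> // x_ls; apply/eqP/sy.
    by rewrite inE negb_or x_ls andbT; move: yF; rewrite -xy inE.
  move=> /setXP[+ /HP v_f] -> /=; rewrite !in_set => uF; apply/forallP => x.
  rewrite permM inE negb_or; have [v_f1 v_f2] := v_f (u x); rewrite v_f1.
  have [xF|xF] := boolP (x \in F).
    have : u x \in F by rewrite perm_closed.
    by move: xF; rewrite !inE => /eqP -> /eqP ->; rewrite !eqxx.
  move: v_f2; rewrite (out_perm uF) // eqxx => v_f2.
  by apply/implyP => /andP[_ /v_f2 ->].
move=> [u v] [u' v'] /setXP[+ /HP vH] /setXP[+ /HP vH'] uv.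
rewrite !in_set /= => uF uF'.
have fixF (w : {perm T}) : (forall x, f (w x) = f x /\ (f x \notin ls -> w x = x)) ->
    forall x, x \in F -> w x = x.
  by move=> wH x; rewrite inE => /eqP fx; apply: (wH x).2; rewrite fx.
(* On [F] both [v] and [v'] are the identity, so there [u] and [u'] agree with the common product;
   elsewhere both are the identity. *)
have uu : u = u'.
  apply/permP => x; have [xF|xF] := boolP (x \in F); last by rewrite !(@out_perm _ F).
  by have /permP/(_ x) := uv; rewrite !permM (fixF v) ?(fixF v') ?perm_closed.
by move: uv; rewrite uu /= => /mulgI ->.
Qed.

(** The solutions form a coset of the label stabilizer of [f]; equal class sizes provide a first
    solution [s]. *)
Lemma card_relabelling n (L : finType) (f g : 'I_n -> L) :
  (forall l, #|[set x | f x == l]| = #|[set x | g x == l]|) ->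
  #|[set s : 'S_n | [forall x, g (s x) == f x]]| =
  \prod_l #|[set x | f x == l]|`!.
Proof.
move=> fg.
have [s gs] : exists s : 'S_n, forall x, g (s x) = f x.
  have /tuple_permP[s fs] : perm_eq [tuple f i | i < n] [tuple g i | i < n].
    apply/allP => l _ /=; rewrite !count_map -!size_filter.
    by have := fg l; rewrite !cardE /enum_mem -!enumT /=
      !(eq_filter (in_set _)) => ->.
  exists s => x; have /(congr1 (fun t => tnth t x)) : [tuple f i | i < n] =
    [tuple tnth [tuple g i  | i < n] (s i) | i < n] by apply: val_inj.
  by rewrite !tnth_mktuple.
rewrite -[RHS]big_enum -card_label_stabilizer_seq ?enum_uniq //=.
rewrite -[RHS](card_imset _ (mulIg s)); apply: eq_card => t.
rewrite in_set; apply/forallP/imsetP => [t_f|[u]].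
  exists (t * s^-1)%g; last by rewrite mulgKV.
  rewrite inE; apply/forallP => x; rewrite mem_enum andbT permM -gs permKV.
  exact: t_f.
rewrite inE => /forallP u_f -> x; rewrite permM gs.
by have /andP[] := u_f x.
Qed.

(** * Strips cut out by two lines *)

Lemma card_ord_interval n lo hi : hi <= n ->
  #|[set z : 'I_n | lo <= z < hi]| = hi - lo.
Proof.
suff -> : #|[set z : 'I_n | lo <= z < hi]| = minn n hi - lo by lia.
rewrite cardsE -sum1_card big_mkcond /=.
elim: n => [|n IHn]; first by rewrite big_ord0; lia.
by rewrite big_ord_recr /= IHn unfold_in /=; case: ifP; lia.
Qed.

(** The number of lines strictly below a point will be the number of its strip. *)
Lemma addn_bool_lt3 (b1 b2 : bool) : b1 + b2 < 3.
Proof. by case: b1; case: b2. Qed.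

(* [inl a] is the open strip number [a]; [inr false] and [inr true] are the
   lines [z = p] and [z = q]. *)
Definition strip_label (p q z : nat) : 'I_3 + bool :=
  if z == p then inr false else if z == q then inr true
  else inl (Ordinal (addn_bool_lt3 (p < z) (q < z))).

Definition widths (n p q : nat) (a : 'I_3) : nat :=
  nth 0 [:: p; q - p.+1; n - q.+1] a.

Lemma strip_label_inl p q z (a : 'I_3) :
  (strip_label p q z == inl a) = [&& z != p, z != q & (p < z) + (q < z) == a].
Proof.
by rewrite /strip_label; case: (eqVneq z p) => //= _; case: (eqVneq z q).
Qed.

Lemma card_strip n p q a : p < q < n ->
  #|[set z : 'I_n | strip_label p q z == inl a]| = widths n p q a.
Proof.
move=> /andP[pq qn]; pose lo := nth 0 [:: 0; p.+1; q.+1] a.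
pose hi := nth 0 [:: p; q; n] a.
have -> : widths n p q a = hi - lo.
  by rewrite /hi /lo /widths; case: a {lo hi} => [[|[|[|]]]] //= _; rewrite subn0.
rewrite -(@card_ord_interval n); last first.
  by rewrite /hi; case: a {lo hi} => [[|[|[|]]]] //= _; lia.
apply: eq_card => z; rewrite !inE strip_label_inl /hi /lo.
by have := ltn_ord z; case: a {lo hi} => [[|[|[|]]]] //= _; lia.
Qed.

Lemma strip_label_inr p q z b : p < q ->
  (strip_label p q z == inr b) = (z == if b then q else p).
Proof.
move=> pq; rewrite /strip_label; have [->|zp] := eqVneq z p.
  by case: b; rewrite ?eqxx // ltn_eqF.
by have [->|zq] := eqVneq z q; case: b; rewrite ?eqxx //=;
  apply/esym/negbTE; rewrite // gtn_eqF.
Qed.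

Lemma card_line n p q b : p < q < n ->
  #|[set z : 'I_n | strip_label p q z == inr b]| = 1.
Proof.
move=> /andP[pq qn]; have pn : p < n by lia.
rewrite -[RHS](cards1 (if b then Ordinal qn else Ordinal pn)); apply: eq_card => z.
by rewrite !inE strip_label_inr // -val_eqE; case: b.
Qed.

Lemma in_strip_label n p q z (a : 'I_3) : p < q < n -> z < n ->
  in_strip (grid_lines n p.+1 q.+1) a z.+1 = (strip_label p q z == inl a).
Proof.
move=> pqn zn; rewrite strip_label_inl /in_strip /grid_lines.
by case: a => [[|[|[|]]]] //= _; lia.
Qed.

(** * Occurrences as relabellings *)

(** The label forced on the value of a point by the label of its position: the two points of the
    occurrence lie on the lines of the same name in both directions. *)
Definition relabel (sigma : 'I_3 -> 'I_3) (l : 'I_3 + bool) : 'I_3 + bool :=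
  if l is inl a then inl (sigma a) else l.

(* The unshaded boxes are [(a, sigma a)] for [a != c]. *)
Definition shaded_off (sigma : 'I_3 -> 'I_3) (c : 'I_3) : {set 'I_3 * 'I_3} :=
  [set u | ~~ ((u.2 == sigma u.1) && (u.1 != c))].

Lemma twelve_shadingsP R : R \in twelve_shadings ->
  exists sigma c, [/\ injective sigma, sigma c != c & R = shaded_off sigma c].
Proof.
pose o k := nth ord0 [:: ord0; Ordinal (isT : 1 < 3); Ordinal (isT : 2 < 3)] k.
pose f (s : seq nat) (a : 'I_3) := o (nth 0 s a).
(* [s] lists the values of [sigma]. In each case [c] and two values are read off the missing boxes,
   and injectivity forces the value at [c]. *)
suff P s c (l : seq (nat * nat)) : s \in permutations [:: 0; 1; 2] -> nth 0 s c != c -> c < 3 ->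
  all (fun a => all (fun b => ((a, b) \in l) == ~~ ((b == nth 0 s a) && (a != c)))
     [:: 0; 1; 2]) [:: 0; 1; 2] ->
  exists sigma c, [/\ injective sigma, sigma c != c & shading l = shaded_off sigma c].
  rewrite !inE => /or4P[/eqP->|/eqP->|/eqP->|]; last first.
    move=> /or4P[/eqP->|/eqP->|/eqP->|]; last first.
      move=> /or4P[/eqP->|/eqP->|/eqP->|]; last first.
        move=> /or3P[] /eqP->.
        exact: (P [:: 0; 2; 1] 1).
        exact: (P [:: 0; 2; 1] 2).
        exact: (P [:: 1; 0; 2] 1).
      exact: (P [:: 1; 0; 2] 0).
      exact: (P [:: 1; 2; 0] 2).
      exact: (P [:: 2; 0; 1] 0).
    exact: (P [:: 2; 0; 1] 1).
    exact: (P [:: 2; 0; 1] 2).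
    exact: (P [:: 1; 2; 0] 0).
  exact: (P [:: 1; 2; 0] 1).
  exact: (P [:: 2; 1; 0] 2).
  exact: (P [:: 2; 1; 0] 0).
rewrite mem_permutations => s_perm sc c3 /allP l_s.
have s_lt3 k : k < 3 -> nth 0 s k < 3.
  move=> k3; have : nth 0 s k \in s by rewrite mem_nth // (perm_size s_perm).
  by rewrite (perm_mem s_perm) !inE; lia.
have o_val k : k < 3 -> o k = k :> nat by case: k => [|[|[|]]].
have fE (a : 'I_3) : f s a = nth 0 s a :> nat by rewrite o_val // s_lt3.
have in3 k : k < 3 -> k \in [:: 0; 1; 2] by case: k => [|[|[|]]].
exists (f s), (Ordinal c3); split.
- move=> a b /(congr1 val) /=; rewrite !fE => /eqP.
  rewrite nth_uniq ?(perm_size s_perm) ?(perm_uniq s_perm) //.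
  by move=> /eqP /val_inj.
- by rewrite -val_eqE /= fE.
apply/setP => -[a b]; rewrite !inE /= -!val_eqE /= fE.
by have /allP/(_ b (in3 _ (ltn_ord b)))/eqP := l_s a (in3 _ (ltn_ord a)).
Qed.

(** A point strictly inside a column must lie in the unshaded box of that column, which names its
    row; column [c] has no such box, hence no point. *)
Lemma mesh12_occurrenceP sigma c n (pi : 'S_n) (i1 i2 : 'I_n) :
  reflect [/\ i1 < i2, pi i1 < pi i2, widths n i1 i2 c = 0 &
      forall k, strip_label (pi i1) (pi i2) (pi k) =
                relabel sigma (strip_label i1 i2 k)]
    (mesh12_occurrence (shaded_off sigma c) pi i1 i2).
Proof.
apply: (iffP and3P) => [[i12 pi12 /forall_inP R_empty] | [i12 pi12 wc0 pi_label]].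
  have lt_n : i1 < i2 < n by rewrite i12 ltn_ord.
  have pi_lt_n : pi i1 < pi i2 < n by rewrite pi12 ltn_ord.
  have pi_label (k : 'I_n) a : strip_label i1 i2 k = inl a ->
      a != c /\ strip_label (pi i1) (pi i2) (pi k) = inl (sigma a).
    move=> ka; case pik : (strip_label _ _ (pi k)) => [b|b].
      have := R_empty (a, b); rewrite inE /= => /contraNT.
      suff -> : [exists k0 : 'I_n, in_strip (grid_lines n i1.+1 i2.+1) a k0.+1 &&
          in_strip (grid_lines n (pi i1).+1 (pi i2).+1) b (pi k0).+1].
        by move=> /(_ isT)/andP[/eqP -> ->].
      apply/existsP; exists k; rewrite !in_strip_label // ka pik.
      by rewrite (eqxx (inl a)) eqxx.
    (* As [k] is on no vertical line, injectivity of [pi] keeps its value off the horizontal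
       ones. *)
    have := strip_label_inr (pi k) b pi12; rewrite pik eqxx.
    have := strip_label_inr k b i12; rewrite ka.
    case: (b) => /esym /eqP ki /esym /eqP /val_inj /perm_inj k_i;
      by case: ki; rewrite k_i.
  split=> // [|k].
    rewrite -card_strip //; apply: eq_card0 => k; rewrite inE.
    by apply/negP => /eqP /pi_label[]; rewrite eqxx.
  case ka : (strip_label i1 i2 k) => [a|b]; first by have [] := pi_label k a.
  have := strip_label_inr k b i12; rewrite ka eqxx => /esym /eqP ki.
  apply/eqP; rewrite strip_label_inr //.
  by case: (b) ki => /val_inj ->.
split=> //; apply/forall_inP => -[a b]; rewrite inE /=; apply: contra.
have lt_n : i1 < i2 < n by rewrite i12 ltn_ord.
have pi_lt_n : pi i1 < pi i2 < n by rewrite pi12 ltn_ord.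
move=> /existsP[k]; rewrite !in_strip_label // pi_label => /andP[ka].
rewrite (eqP ka) => /eqP[<-]; rewrite eqxx /=.
apply: contraPneq ka => ->.
move: wc0; rewrite -card_strip // => /eqP; rewrite cards_eq0 => /eqP /setP /(_ k).
by rewrite !inE => ->.
Qed.

(** [pi] restricts to a bijection from the positions in strip [a] to the values in strip
    [sigma a]. *)
Lemma widths_perm n (pi : 'S_n) sigma x1 x2 y1 y2 a : injective sigma ->
  x1 < x2 < n -> y1 < y2 < n ->
  (forall k : 'I_n,
      strip_label y1 y2 (pi k) = relabel sigma (strip_label x1 x2 k)) ->
  widths n y1 y2 (sigma a) = widths n x1 x2 a.
Proof.
move=> sigma_inj x_lt y_lt pi_label; rewrite -!card_strip //.
rewrite -[RHS](card_imset _ (@perm_inj _ pi)); apply: eq_card => z.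
have relabel_inl l : (relabel sigma l == inl (sigma a)) = (l == inl a).
  case: l => //= b; apply/eqP/eqP => [[/sigma_inj ->] | [->]] //.
rewrite in_set; apply/idP/imsetP => [za | [k]].
  exists ((pi^-1)%g z); last by rewrite permKV.
  by rewrite in_set -relabel_inl -pi_label permKV.
by rewrite in_set => ka ->; rewrite pi_label relabel_inl.
Qed.

(* Column [c] and row [sigma c] are both empty; as [sigma c != c], each of the
   six possible cases fixes one end of the occurrence absolutely and ties the
   other end to it. *)
Lemma mesh12_occurrence_unique sigma c n (pi : 'S_n) (i1 i2 j1 j2 : 'I_n) :
  injective sigma -> sigma c != c ->
  mesh12_occurrence (shaded_off sigma c) pi i1 i2 ->
  mesh12_occurrence (shaded_off sigma c) pi j1 j2 -> (i1, i2) = (j1, j2).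
Proof.
move=> sigma_inj sc /mesh12_occurrenceP[i12 pi12 ic pi_i].
move=> /mesh12_occurrenceP[j12 pj12 jc pi_j].
have := widths_perm c sigma_inj _ _ pi_i; rewrite ic i12 pi12 !ltn_ord.
move=> /(_ isT isT) id.
have := widths_perm c sigma_inj _ _ pi_j; rewrite jc j12 pj12 !ltn_ord.
move=> /(_ isT isT) jd.
(* One end may be fixed by its position and the other tied to it by value, or conversely; these
   equivalences carry equalities across. *)
have pi_eq (x y : 'I_n) : (x = y :> nat) <-> (pi x = pi y :> nat).
  by split=> [/val_inj -> | /val_inj /perm_inj ->].
have [eq1 eq2] := (pi_eq i1 j1, pi_eq i2 j2).
have [lti2 ltj2 plti2 pltj2] :
  [/\ i2 < n, j2 < n, pi i2 < n & pi j2 < n] by split.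
suff [/val_inj -> /val_inj ->] : (i1 = j1 :> nat) /\ (i2 = j2 :> nat) by [].
move: sc ic jc id jd; rewrite /widths -val_eqE.
by case: (sigma c) => [[|[|[|]]] //= _]; case: (c) => [[|[|[|]]] //= _] _; lia.
Qed.

(** * Permutations with an occurrence at a given place *)

Definition mid3 : 'I_3 := Ordinal (isT : 1 < 3).
(** The cuts invert [widths]: they are the 0-based lines whose strips hold [w] points each, the
    successor in [cut2] accounting for the point on the first line. *)
Definition cut1 (w : 'I_3 -> nat) : nat := w ord0.
Definition cut2 (w : 'I_3 -> nat) : nat := (w ord0 + w mid3).+1.

Lemma sum_ord3 (w : 'I_3 -> nat) :
  \sum_a w a = w ord0 + w mid3 + w ord_max.
Proof.
rewrite !big_ord_recl big_ord0 addn0 addnA.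
by congr (_ + w _ + w _); apply: val_inj.
Qed.

Lemma cuts_lt (w : 'I_3 -> nat) : cut1 w < cut2 w < (\sum_a w a).+2.
Proof. by rewrite /cut1 /cut2 sum_ord3; lia. Qed.

Lemma widths_cuts (w : 'I_3 -> nat) a :
  widths (\sum_a w a).+2 (cut1 w) (cut2 w) a = w a.
Proof.
rewrite sum_ord3 /widths /cut1 /cut2.
case: a => [[|[|[|]]] //= ha].
- by congr w; apply: val_inj.
- rewrite subSS addKn; by congr w; apply: val_inj.
rewrite !subSS addKn; by congr w; apply: val_inj.
Qed.

(** The column widths determine the row widths, hence the two values of the occurrence. What remains
    is to count relabellings, where each line class has one point and contributes a factor 1. *)
Lemma card_occurrence_at sigma c n (w : 'I_3 -> nat) (i1 i2 : 'I_n) :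
  injective sigma -> n = (\sum_a w a).+2 -> w c = 0 ->
  i1 = cut1 w :> nat -> i2 = cut2 w :> nat ->
  #|[set pi : 'S_n | mesh12_occurrence (shaded_off sigma c) pi i1 i2]| =
  \prod_a (w a)`!.
Proof.
(* [h] gives the row widths: row [b] receives the points of column [sigma^-1 b]. *)
move=> sigma_inj nE wc i1E i2E; pose h b := w (invF sigma_inj b).
have hE : \sum_b h b = \sum_a w a.
  rewrite [RHS](reindex_inj (can_inj (f_invF sigma_inj))); exact: eq_bigr.
have x_lt : i1 < i2 < n by rewrite i1E i2E nE cuts_lt.
have y_lt : cut1 h < cut2 h < n by rewrite nE -hE cuts_lt.
pose f (k : 'I_n) := relabel sigma (strip_label i1 i2 k).
pose g (z : 'I_n) := strip_label (cut1 h) (cut2 h) z.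
have cardf b : #|[set x | f x == inl b]| = h b.
  rewrite /h -widths_cuts -nE -i1E -i2E -card_strip //.
  apply: eq_card => x; rewrite !in_set /f.
  case: (strip_label _ _ x) => //= a.
  by apply/eqP/eqP => [[<-] | [->]]; rewrite ?invF_f ?f_invF.
have cardf_line b : #|[set x | f x == inr b]| = 1.
  rewrite -[RHS](card_line b x_lt); apply: eq_card => x; rewrite !in_set /f.
  by case: (strip_label _ _ x).
transitivity #|[set s : 'S_n | [forall x, g (s x) == f x]]|.
  apply: eq_card => pi; rewrite !in_set.
  have [i12 _] := andP x_lt; have [h12 _] := andP y_lt.
  apply/mesh12_occurrenceP/forallP => [[_ pi12 _ pi_label] x | pi_label].
    have wpi b : widths n (pi i1) (pi i2) b = h b.
      rewrite -{1}(f_invF sigma_inj b) (widths_perm _ sigma_inj x_lt _ pi_label).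
        by rewrite i1E i2E nE widths_cuts.
      by rewrite pi12 ltn_ord.
    rewrite /g /cut2 /cut1 -!wpi /widths /= -addSn subnKC //.
    by apply/eqP/pi_label.
  (* Conversely, [i1] and [i2] carry line labels, so their values are the two cuts of [h]. *)
  have := pi_label i1; rewrite /g /f {2}/strip_label eqxx strip_label_inr //.
  move=> /eqP pi1; have := pi_label i2; rewrite /g /f.
  have /eqP -> : strip_label i1 i2 i2 == inr true by rewrite strip_label_inr.
  rewrite strip_label_inr // => /eqP pi2.
  split; rewrite ?pi1 ?pi2 //; last by move=> k; apply/eqP/pi_label.
  by rewrite i1E i2E nE widths_cuts.
rewrite card_relabelling => [|[b|b]]; first last.
- by rewrite cardf_line card_line.
- by rewrite cardf card_strip // nE -hE widths_cuts.
rewrite big_sumType /= [X in _ * X]big1 ?muln1 => [|b _]; last first.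
  by rewrite cardf_line.
rewrite [RHS](reindex_inj (can_inj (f_invF sigma_inj))).
by apply: eq_bigr => b _; rewrite cardf.
Qed.

(* The strip [c] is left empty and the [m] remaining points are shared out
   among the two other strips, [j] of them going to the next one cyclically. *)
Definition split_widths (m : nat) (c : 'I_3) (j : nat) (a : 'I_3) : nat :=
  if a == c then 0 else if a == ordS c then j else m - j.

Lemma sum_split_widths m c j : j <= m -> \sum_a split_widths m c j a = m.
Proof.
move=> jm; rewrite sum_ord3 /split_widths.
by case: c => [[|[|[|]]] //= hc]; rewrite -?val_eqE /=; lia.
Qed.

Lemma prod_split_widths m c j :
  \prod_a (split_widths m c j a)`! = j`! * (m - j)`!.
Proof.
rewrite !big_ord_recl big_ord0 muln1 /split_widths.
by case: c => [[|[|[|]]] //= hc]; rewrite /= ?mul1n ?muln1 // mulnC.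
Qed.

Definition split_cuts (m : nat) (c : 'I_3) (j : 'I_m.+1) : 'I_m.+2 * 'I_m.+2 :=
  (inord (cut1 (split_widths m c j)), inord (cut2 (split_widths m c j))).

(** The widths sum to [m], so both cuts are below [m.+2] and [inord] never takes its default
    value. *)
Lemma split_cutsE m c (j : 'I_m.+1) :
  ((split_cuts c j).1 = cut1 (split_widths m c j) :> nat) *
  ((split_cuts c j).2 = cut2 (split_widths m c j) :> nat).
Proof.
have := cuts_lt (split_widths m c j); rewrite sum_split_widths; last first.
  by rewrite -ltnS.
by move=> lt_m; split; rewrite inordK //; lia.
Qed.

Lemma split_cuts_inj m c : injective (@split_cuts m c).
Proof.
move=> j k jk; have := split_cutsE c j; rewrite jk !(split_cutsE c k).
case=> e1 e2; apply: val_inj; move: e1 e2; rewrite /cut1 /cut2 /split_widths.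
have := ltn_ord j; have := ltn_ord k.
by case: c {jk} => [[|[|[|]]] //= hc]; rewrite -?val_eqE /=; lia.
Qed.

(** The witness is the width of the strip that follows [c] cyclically. *)
Lemma split_cuts_surj m c (i1 i2 : 'I_m.+2) : i1 < i2 ->
  widths m.+2 i1 i2 c = 0 -> exists j, (i1, i2) = split_cuts c j.
Proof.
move=> i12 wc; have i2m := ltn_ord i2.
have jm : widths m.+2 i1 i2 (ordS c) < m.+1.
  by case: c wc => [[|[|[|]]] //= hc]; rewrite /widths /=; lia.
exists (Ordinal jm); have [e1 e2] := split_cutsE c (Ordinal jm).
apply/eqP; rewrite xpair_eqE -?val_eqE /= e1 e2 /cut1 /cut2 /split_widths /=.
by case: c wc {jm e1 e2} => [[|[|[|]]] //= hc]; rewrite -?val_eqE /widths /=; lia.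
Qed.

Lemma mesh12_count_le1 sigma c n (pi : 'S_n) : injective sigma -> sigma c != c ->
  mesh12_count (shaded_off sigma c) pi <= 1.
Proof.
move=> sigma_inj sc; apply/card_le1_eqP => -[i1 i2] [j1 j2].
rewrite !in_set => /= occ_i occ_j.
exact: (mesh12_occurrence_unique sigma_inj sc occ_j occ_i).
Qed.

(** Double counting: the possible places of an occurrence are indexed by [j], and the sums over
    permutations and over places are exchanged. *)
Lemma sum_mesh12_count sigma c n : injective sigma ->
  \sum_(pi : 'S_n) mesh12_count (shaded_off sigma c) pi =
  \sum_(1 <= i < n) (i - 1)`! * (n - i - 1)`!.
Proof.
move=> sigma_inj; have [n_lt2 | ] := ltnP n 2.
  rewrite big_geq // big1 // => pi _.
  apply: eq_card0 => -[i1 i2]; rewrite in_set /=; apply/negP => /and3P[i12 _ _].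
  by have := ltn_ord i2; lia.
case: n => [|[|m]] // _.
transitivity (\sum_(pi : 'S_m.+2) \sum_(j < m.+1)
    mesh12_occurrence (shaded_off sigma c) pi (split_cuts c j).1 (split_cuts c j).2).
  apply: eq_bigr => pi _; rewrite -big_mkcond sum1dep_card.
  rewrite -(card_imset _ (@split_cuts_inj m c)); apply: eq_card => -[i1 i2].
  rewrite in_set; apply/idP/imsetP => [occ | [j]]; last first.
    by rewrite in_set => + ->.
  have /mesh12_occurrenceP[i12 _ wc _] := occ.
  have [j E] : exists j, (i1, i2) = split_cuts c j := split_cuts_surj i12 wc.
  by exists j; rewrite // in_set -E.
(* With [n = m + 2], the index of the target sum is [i = j + 1]. *)
rewrite exchange_big /= big_add1 /= big_mkord; apply: eq_bigr => j _.
have jm : j <= m by rewrite -ltnS.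
rewrite -big_mkcond sum1dep_card (card_occurrence_at (w := split_widths m c j)) //.
- by rewrite prod_split_widths subn1 /= !subSS subSn // subn1.
- by rewrite sum_split_widths.
- by rewrite /split_widths eqxx.
- by rewrite split_cutsE.
by rewrite split_cutsE.
Qed.

(** * Distribution for the twelve patterns *)

Lemma twelve_mesh12_count_le1 R n (pi : 'S_n) : R \in twelve_shadings ->
  mesh12_count R pi <= 1.
Proof. by move=> /twelve_shadingsP[s [c [s_inj sc ->]]]; apply: mesh12_count_le1. Qed.

(** A count that is at most 1 is its own indicator, so its sum over all permutations is the number
    of those with count 1. *)
Lemma twelve_distr1 R n : R \in twelve_shadings ->
  mesh12_distr n 1 R = \sum_(1 <= i < n) (i - 1)`! * (n - i - 1)`!.
Proof.
move=> R12; have [s [c [s_inj sc RE]]] := twelve_shadingsP R12.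
rewrite -(sum_mesh12_count c _ s_inj) -RE /mesh12_distr -sum1dep_card big_mkcond.
apply: eq_bigr => pi _; have := twelve_mesh12_count_le1 pi R12.
by case: (mesh12_count R pi) => [|[|]].
Qed.

Lemma twelve_distr0 R n : R \in twelve_shadings ->
  mesh12_distr n 0 R + mesh12_distr n 1 R = n`!.
Proof.
move=> R12; have := cardsC [set pi : 'S_n | mesh12_count R pi == 1].
rewrite card_Sn addnC => <-; congr (_ + _).
apply: eq_card => pi; rewrite !inE; have := twelve_mesh12_count_le1 pi R12.
by case: (mesh12_count R pi) => [|[|]].
Qed.

Lemma twelve_distr_ge2 R n k : R \in twelve_shadings ->
  mesh12_distr n k.+2 R = 0.
Proof.
move=> R12; apply: eq_card0 => pi; rewrite inE; apply/negbTE/eqP => pi_k.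
by have := twelve_mesh12_count_le1 pi R12; rewrite pi_k.
Qed.

Import GRing.Theory.
Local Open Scope ring_scope.

Theorem theorem3p2 :
  (forall R1 R2 : {set 'I_3 * 'I_3},
     R1 \in twelve_shadings -> R2 \in twelve_shadings ->
     equidistributed R1 R2) /\
  (forall (R : {set 'I_3 * 'I_3}) (n : nat),
     R \in twelve_shadings -> (1 <= n)%N ->
     \sum_(pi : 'S_n) 'X ^+ mesh12_count R pi =
       (n`!)%:R - \sum_(1 <= i < n) ((i - 1)`! * (n - i - 1)`!)%:R
       + 'X * (\sum_(1 <= i < n) ((i - 1)`! * (n - i - 1)`!)%:R)
       :> {poly int}).
Proof.
split=> [R1 R2 R1_12 R2_12 n k | R n R12 _].
  case: k => [|[|k]]; rewrite ?twelve_distr1 ?twelve_distr_ge2 //.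
  (* For [k = 0], adding the common number of permutations with count 1 turns both sides into
     [n!]. *)
  by apply/(@addIn (mesh12_distr n 1 R1)); rewrite {2}twelve_distr1 //
    -(twelve_distr1 _ R2_12) !twelve_distr0.
rewrite -natr_sum -(twelve_distr1 n R12) -(twelve_distr0 n R12) natrD addrK.
(* The permutations with count 0 give the constant term, those with count 1 the coefficient of
   ['X]. *)
rewrite (bigID (fun pi => mesh12_count R pi == 1)) /= addrC; congr (_ + _).
  rewrite /mesh12_distr -sum1dep_card natr_sum; apply: eq_big => pi.
    have := twelve_mesh12_count_le1 pi R12.
    by case: (mesh12_count R pi) => [|[|]].
  have := twelve_mesh12_count_le1 pi R12.
  by case: (mesh12_count R pi) => [|[|]].
rewrite /mesh12_distr -sum1dep_card natr_sum mulr_sumr; apply: eq_bigr => pi.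
by move=> /eqP ->; rewrite mulr1.
Qed.
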